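(* Consider the fully dynamic algorithm described below, run on a stream of exactly $n$ insertions and $n$ deletions, where $n$ is a power of $2$ known in advance. For every operation $i\in\{1,\dots,2n\}$, the set $S^i:=S_L$ held by the algorithm at the end of the processing of operation $i$ is independent, contained in $V_i$, and satisfies $\operatorname{OPT}_i\le 4 f(S^i)$ deterministically.
   Context: Setting: $f:2^V\to\mathbb{R}_{\ge0}$ is monotone, submodular and normalized ($f(\emptyset)=0$), accessed via a value oracle; $f(X\mid Y)=f(X\cup Y)-f(Y)$. $\mathcal{M}$ is a matroid on $V$ of rank $k$, accessed via an independence oracle. A stream of insertions and deletions of elements of $V$ is fixed by an oblivious adversary (a deletion removes a currently present element). $V_i$ is the set of elements inserted and not deleted during the first $i$ operations, and $\operatorname{OPT}_i=\max\{f(T): T\subseteq V_i,\ T\in\mathcal{M}\}$. Algorithm: let $L=\log_2 n$. For each level $\ell=0,\dots,L$ maintain sets $S_\ell,S'_\ell,A_\ell,B_\ell$, all initially empty. Whenever an element is put into some $S_\ell$, its current weight $w(e)$ is stored with it (copying a set copies the stored weights). Insertion$(e)$: add $e$ to $B_\ell$ for all $\ell$; if some $\ell$ satisfies $|B_\ell|\ge n/2^\ell$, call LevelConstruct$(\ell^\star)$ for the smallest such $\ell^\star$. Deletion$(e)$: remove $e$ from all $A_\ell$ and all $B_\ell$; if $e\in S_\ell$ for some $\ell$, call LevelConstruct$(\ell)$ for the smallest such $\ell$. LevelConstruct$(\ell)$: set $A_\ell\gets A_{\ell-1}\cup B_{\ell-1}$, $B_\ell\gets\emptyset$, $S_\ell\gets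 S_{\ell-1}$, $S'_\ell\gets S'_{\ell-1}$ (for $\ell=0$: $A_{-1}\cup B_{-1}$ is the set of currently present elements and $S_{-1}=S'_{-1}=\emptyset$). Then repeat: for every $e\in A_\ell$ set $w(e)\gets f(e\mid S'_\ell)$ and $s_e\in\arg\min\{w(y): y\in S_\ell,\ S_\ell-y+e\in\mathcal{M}\}$ (stored weights for $y$); let $E_\ell=\{e\in A_\ell: S_\ell+e\in\mathcal{M}\}$, $F_\ell=\{e\in A_\ell\setminus E_\ell: w(e)>2w(s_e)\}$, $A_\ell\gets E_\ell\cup F_\ell$; if $|A_\ell|\ge n/2^\ell$, remove an element $e$ from $A_\ell$ uniformly at random and set $S_\ell\gets S_\ell+e-s_e$ (no removal if $e\in E_\ell$) and $S'_\ell\gets S'_\ell+e$; until $|A_\ell|<n/2^\ell$. Finally, if $\ell<L$ call LevelConstruct$(\ell+1)$. The solution after each operation is $S_L$. *)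

(* Defs.v *)
From mathcomp Require Import all_boot all_order all_algebra.
From mathcomp Require Import reals.

Set Implicit Arguments.
Unset Strict Implicit.
Unset Printing Implicit Defensive.

Import Order.TTheory GRing.Theory Num.Theory.
Local Open Scope ring_scope.

Record matroid (V : finType) := Matroid {
  indep : {set V} -> bool;
  indep0 : indep set0;
  indep_sub : forall A B : {set V}, A \subset B -> indep B -> indep A;
  indep_aug : forall A B : {set V}, indep A -> indep B -> (#|A| < #|B|)%N ->
    exists2 x, x \in B :\: A & indep (x |: A)
}.

Section SetFunctions.
Context {R : realType} {V : finType}.
Implicit Types (f : {set V} -> R) (X Y : {set V}).

Definition marginal f X Y : R := f (X :|: Y) - f Y.

Definition set_nonneg f := forall X, 0 <= f X.

Definition set_normalized f := f set0 = 0.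

Definition set_monotone f := forall X Y, X \subset Y -> f X <= f Y.

Definition set_submodular f := forall X Y e,
  X \subset Y -> e \notin Y -> marginal f [set e] Y <= marginal f [set e] X.

(* [set0] belongs to the family, so the default value of the big operator
   does not change the maximum. *)
Definition opt f (M : matroid V) X : R :=
  \big[Num.max/f set0]_(T : {set V} | (T \subset X) && indep M T) f T.

End SetFunctions.

Section Streams.
Context {V : finType}.

Inductive op := Ins of V | Del of V.

Definition is_ins (o : op) : bool := if o is Ins _ then true else false.
Definition is_del (o : op) : bool := ~~ is_ins o.

Definition apply_op (X : {set V}) (o : op) : {set V} :=
  match o with Ins e => e |: X | Del e => X :\ e end.

Definition present (ops : seq op) : {set V} := foldl apply_op set0 ops.

(* An element may be inserted again once it has been deleted. *)
Definition legal_op (X : {set V}) (o : op) : bool :=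
  match o with Ins e => e \notin X | Del e => e \in X end.

Definition legal_stream (ops : seq op) : Prop :=
  forall ops1 o ops2, ops = ops1 ++ o :: ops2 -> legal_op (present ops1) o.

End Streams.
Arguments op V : clear implicits.

(* The algorithm is a nondeterministic transition system: a uniform draw from
   a set becomes "any element of the set", and ties in the argmin defining
   [s_e] are broken arbitrarily. *)
Section Algorithm.
Context {R : realType} {V : finType}.

(* [lvW] holds the weights stored with the elements of [lvS]; its values
   elsewhere are never read. *)
Record level := Level {
  lvA : {set V};
  lvB : {set V};
  lvS : {set V};
  lvS' : {set V};
  lvW : V -> R
}.

(* Only the entries at indices [0, ..., L] are ever read. *)
Definition state := nat -> level.

Definition empty_level : level := Level set0 set0 set0 set0 (fun=> 0).
Definition init_state : state := fun=> empty_level.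

Definition set_level (st : state) (l : nat) (c : level) : state :=
  fun l' => if l' == l then c else st l'.

Context (f : {set V} -> R) (M : matroid V) (n L : nat).

(* The quotient is exact for [n = 2 ^ L] and [l <= L]. *)
Definition threshold (l : nat) : nat := (n %/ 2 ^ l)%N.

Definition least_level (P : pred nat) : option nat :=
  ohead [seq l <- iota 0 L.+1 | P l].

Definition swap_candidates (S : {set V}) (e : V) : {set V} :=
  [set y in S | indep M (e |: (S :\ y))].

(* [None] when the argmin ranges over the empty set, which for an independent
   [S] not containing [e] happens only if [e] is a loop. *)
Definition is_swap (S : {set V}) (W : V -> R) (e : V) (s : option V) : Prop :=
  match s with
  | Some y => y \in swap_candidates S e /\
              forall z, z \in swap_candidates S e -> W y <= W z
  | None => swap_candidates S e = set0
  end.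

Definition weight (S' : {set V}) (e : V) : R := marginal f [set e] S'.

Definition addable (c : level) : {set V} :=
  [set e in lvA c | indep M (e |: lvS c)].

Definition swappable (c : level) (s : V -> option V) : {set V} :=
  [set e in lvA c :\: addable c |
    if s e is Some y then 2 * lvW c y < weight (lvS' c) e else false].

Definition select (c : level) (s : V -> option V) (e : V) : level :=
  Level ((addable c :|: swappable c s) :\ e)
        (lvB c)
        (if e \in addable c then e |: lvS c
         else if s e is Some y then (e |: lvS c) :\ y else e |: lvS c)
        (e |: lvS' c)
        (fun x => if x == e then weight (lvS' c) e else lvW c x).

Definition iteration (t : nat) (c c' : level) : Prop :=
  exists2 s : V -> option V,
    (forall e, e \in lvA c -> is_swap (lvS c) (lvW c) e (s e)) &
    let A := addable c :|: swappable c s in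
    if (t <= #|A|)%N then exists2 e, e \in A & c' = select c s e
    else c' = Level A (lvB c) (lvS c) (lvS' c) (lvW c).

Inductive repeat_until (t : nat) : level -> level -> Prop :=
| repeat_done c c' :
    iteration t c c' -> (#|lvA c'| < t)%N -> repeat_until t c c'
| repeat_next c c' c'' :
    iteration t c c' -> (t <= #|lvA c'|)%N -> repeat_until t c' c'' ->
    repeat_until t c c''.

Definition start_level (X : {set V}) (st : state) (l : nat) : level :=
  if l is l'.+1 then
    let p := st l' in Level (lvA p :|: lvB p) set0 (lvS p) (lvS' p) (lvW p)
  else Level X set0 set0 set0 (fun=> 0).

Inductive level_construct (X : {set V}) : nat -> state -> state -> Prop :=
| construct_last st c :
    repeat_until (threshold L) (start_level X st L) c ->
    level_construct X L st (set_level st L c)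
| construct_next l st c st' :
    (l < L)%N ->
    repeat_until (threshold l) (start_level X st l) c ->
    level_construct X l.+1 (set_level st l c) st' ->
    level_construct X l st st'.

Definition construct_from (X : {set V}) (l : option nat) (st st' : state) :=
  if l is Some l' then level_construct X l' st st' else st' = st.

(* [X] is the set of elements present once the operation has been applied. *)
Definition insertion (X : {set V}) (e : V) (st st' : state) : Prop :=
  let st1 l :=
    let c := st l in Level (lvA c) (e |: lvB c) (lvS c) (lvS' c) (lvW c) in
  construct_from X
    (least_level (fun l => (threshold l <= #|lvB (st1 l)|)%N)) st1 st'.

Definition deletion (X : {set V}) (e : V) (st st' : state) : Prop :=
  let st1 l :=
    let c := st l in
    Level (lvA c :\ e) (lvB c :\ e) (lvS c) (lvS' c) (lvW c) in
  construct_from X (least_level (fun l => e \in lvS (st1 l))) st1 st'.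

Definition process (X : {set V}) (o : op V) (st st' : state) : Prop :=
  match o with
  | Ins e => insertion X e st st'
  | Del e => deletion X e st st'
  end.

(* [outcome ops st]: [st] is a possible state after processing [ops]. *)
Inductive outcome : seq (op V) -> state -> Prop :=
| outcome_nil : outcome [::] init_state
| outcome_rcons ops o st st' :
    outcome ops st -> process (present (rcons ops o)) o st st' ->
    outcome (rcons ops o) st'.

Lemma iteration_total t c : (0 < t)%N ->
  exists2 c', iteration t c c' & (#|lvA c'| < t)%N \/ (#|lvA c'| < #|lvA c|)%N.
Proof.
move=> t0.
have swapE e : exists s, is_swap (lvS c) (lvW c) e s.
  have [C0|[y yC]] := set_0Vmem (swap_candidates (lvS c) e).
    by exists None.
  exists (Some [arg min_(z < y in swap_candidates (lvS c) e) lvW c z]%O).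
  by case: arg_minP.
have [s sP] : exists s : {ffun V -> option V},
    forall e, is_swap (lvS c) (lvW c) e (s e).
  have [s sP] := fin_all_exists swapE.
  by exists [ffun e => s e] => e; rewrite ffunE.
pose A := addable c :|: swappable c s.
have sA : A \subset lvA c.
  by apply/subsetP => e; rewrite !inE => /orP[/andP[]//|/andP[/andP[]]].
have [tA|At] := leqP t #|A|.
  have /card_gt0P[e eA] : (0 < #|A|)%N by exact: leq_trans tA.
  exists (select c s e); first by exists s => //=; rewrite -/A tA; exists e.
  right; rewrite /= -/A.
  by apply: (leq_trans _ (subset_leq_card sA)); rewrite (cardsD1 e A) eA.
exists (Level A (lvB c) (lvS c) (lvS' c) (lvW c)); last by left.
by exists s => //=; rewrite -/A leqNgt At.
Qed.

Lemma repeat_until_total t c : (0 < t)%N -> exists c', repeat_until t c c'.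
Proof.
move=> t0; have [m] := ubnP #|lvA c|; elim: m c => // m IH c cm.
have [c' cc' dec] := iteration_total c t0.
have [lt|ge] := ltnP #|lvA c'| t; first by exists c'; apply: repeat_done.
case: dec => [|lt]; first by rewrite ltnNge ge.
have [c'' H] := IH c' (leq_trans lt cm).
by exists c''; apply: repeat_next H.
Qed.

Lemma level_construct_total X l st : n = (2 ^ L)%N -> (l <= L)%N ->
  exists st', level_construct X l st st'.
Proof.
move=> nE; have t0 k : (k <= L)%N -> (0 < threshold k)%N.
  by move=> kL; rewrite divn_gt0 ?expn_gt0// nE leq_exp2l.
elim/ltn_ind: {l}(L - l)%N {-2}l (erefl (L - l)%N) st => d IH l dE st lL.
have [c Hc] := repeat_until_total (start_level X st l) (t0 l lL).
move: lL; rewrite leq_eqVlt => /orP[/eqP lE|lL].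
  by subst l; exists (set_level st L c); apply: construct_last.
have [|st' H] := IH (L - l.+1)%N _ l.+1 erefl (set_level st l c) lL.
  by rewrite -dE ltn_sub2l.
by exists st'; apply: construct_next H.
Qed.

(* Quantifying over all outcomes is therefore never vacuous. *)
Lemma outcome_total ops : n = (2 ^ L)%N -> exists st, outcome ops st.
Proof.
move=> nE; elim/last_ind: ops => [|ops o [st Hst]].
  by exists init_state; apply: outcome_nil.
have cf X P st1 : exists st', construct_from X (least_level P) st1 st'.
  rewrite /construct_from.
  have : forall l, least_level P = Some l -> (l <= L)%N.
    move=> l; rewrite /least_level => hl.
    have : l \in [seq l <- iota 0 L.+1 | P l].
      by case: filter hl => //= a r [->]; rewrite mem_head.
    by rewrite mem_filter mem_iota => /andP[].
  case: least_level => [l /(_ _ erefl) lL|_]; last by exists st1.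
  exact: level_construct_total.
have [st' H] : exists st', process (present (rcons ops o)) o st st'.
  by case: o => e; apply: cf.
by exists st'; apply: outcome_rcons H.
Qed.

End Algorithm.
Arguments level R V : clear implicits.
Arguments state R V : clear implicits.

(* Main.v *)
Require Import Defs.
From mathcomp Require Import all_boot all_order all_algebra.
From mathcomp Require Import reals.
From mathcomp Require Import lra.

Set Implicit Arguments.
Unset Strict Implicit.
Unset Printing Implicit Defensive.

Import Order.TTheory GRing.Theory Num.Theory.
Local Open Scope ring_scope.

(** Write w(S) for the total stored weight of S and v(e) = f(e | S'). A swap
    exchanges y for an element of more than twice its weight, so it raises w(S)
    by at least half of the gain of f(S'), whence f(S') <= 2 w(S); submodularity
    gives w(T) <= f(T) for every T included in S. A discarded element e is
    spanned by {y in S | v(e) <= 2 w(y)}, and this survives later swaps because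
    the removed element is the lightest one on its circuit. Hence an independent
    set T of discarded elements has, for every t > 0, at most as many elements
    with v(e) >= t as S has with 2 w(y) >= t, and so v(T) <= 2 w(S). Altogether
    f(T) <= f(S') + v(T) <= 4 w(S) <= 4 f(S). Deleted elements may linger in S',
    which none of these inequalities minds, and at level L both A and B are
    empty, so that every present element has been discarded or selected. *)

Lemma disjoint_setU (V : finType) (A B C : {set V}) :
  [disjoint A :|: B & C] = [disjoint A & C] && [disjoint B & C].
Proof. by rewrite !disjoints_subset subUset. Qed.

(** * Matroids *)

Section Matroids.
Context {V : finType} (M : matroid V).
Implicit Types (I J S T : {set V}) (e x y : V).

(** For independent [I] this is the matroid closure. The first disjunct is there because [e |: I] is
    just [I] when [e] lies in [I]. *)
Definition spanned I e : bool := (e \in I) || ~~ indep M (e |: I).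

Lemma spanned_sub I J e : I \subset J -> spanned I e -> spanned J e.
Proof.
move=> sIJ /orP[eI|nI]; first by rewrite /spanned (subsetP sIJ).
apply/orP; right; apply: contra nI; apply: indep_sub.
by rewrite setUS.
Qed.

Lemma card_le_of_spanned I T : indep M I -> indep M T ->
  (forall e, e \in T -> spanned I e) -> (#|T| <= #|I|)%N.
Proof.
move=> iI iT sp; rewrite leqNgt; apply/negP => lt.
have [x /setDP[xT xI] ix] := indep_aug iI iT lt.
by move: (sp _ xT); rewrite /spanned (negPf xI) ix.
Qed.

(** The exchange keeps the cardinality. Were [x] outside the new span, adding it would give an
    independent set larger than [I], and augmenting [I] from it could only add [x] or [e], both of
    which [I] spans. *)
Lemma spanned_exchange I y e x : indep M I -> y \in I -> e \notin I ->
  ~~ indep M (e |: I) -> indep M (e |: (I :\ y)) ->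
  spanned I x -> spanned (e |: (I :\ y)) x.
Proof.
move=> iI yI eI de iI' spx; rewrite /spanned.
have [//|xI'] := boolP (x \in e |: (I :\ y)); apply/negP => /= ix.
have lt : (#|I| < #|x |: (e |: (I :\ y))|)%N.
  by rewrite !cardsU1 xI' !inE (negPf eI) andbF/= (cardsD1 y I) yI.
have [z] := indep_aug iI ix lt.
rewrite !inE => /andP[zI /orP[/eqP zE|/orP[/eqP zE|/andP[_ zI2]]]] iz.
- by subst z; move: spx; rewrite /spanned (negPf zI) iz.
- by subst z; rewrite iz in de.
- by rewrite zI2 in zI.
Qed.

Lemma indep_extend I S : indep M I -> indep M S ->
  exists J, [/\ I \subset J, J \subset I :|: S, indep M J & (#|S| <= #|J|)%N].
Proof.
move=> + iS; have [m] := ubnP (#|S| - #|I|)%N; elim: m I => // m IH I Im iI.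
have [le|lt] := leqP #|S| #|I|.
  by exists I; split=> //; apply: subsetUl.
have [x /setDP[xS xI] ix] := indep_aug iI iS lt.
have [|J [sJ Js iJ cJ]] := IH (x |: I) _ ix.
  by rewrite cardsU1 xI add1n subnS -ltnS prednK ?subn_gt0.
exists J; split=> //; first by apply: subset_trans sJ; apply: subsetUr.
apply: (subset_trans Js); rewrite !subUset subsetUl subsetUr sub1set !andbT.
by rewrite inE xS orbT.
Qed.

(** Extend [e |: I] within [e |: S] to an independent [J] at least as large as [S]. As [e |: S] is
    dependent, [J] misses one of its elements, and this one can be exchanged for [e]. *)
Lemma swap_candidate_notin S I e : indep M S -> I \subset S ->
  ~~ indep M (e |: S) -> indep M (e |: I) ->
  exists2 z, z \in swap_candidates M S e & z \notin I.
Proof.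
move=> iS sIS dS iI.
have eS : e \notin S by apply: contra dS => eS; rewrite (setUidPr _)// sub1set.
have [J [sJ Js iJ cJ]] := indep_extend iI iS.
have JsS : J \subset e |: S.
  by apply: (subset_trans Js); rewrite -setUA subUset subsetUl/= subUset subsetUr
    (subset_trans sIS) ?subsetUr.
have /subsetPn[z zeS zJ] : ~~ (e |: S \subset J).
  by apply: contra dS => sub; apply: indep_sub sub iJ.
have eJ : e \in J by rewrite (subsetP sJ)// setU11.
have zS : z \in S.
  by move: zeS; rewrite !inE => /orP[/eqP zE|//]; rewrite zE eJ in zJ.
exists z; last by apply: contra zJ => zI; rewrite (subsetP sJ)// inE zI orbT.
rewrite inE zS/=; suff <- : J = e |: S :\ z by [].
apply/eqP; rewrite eqEcard; apply/andP; split.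
  apply/subsetP => x xJ; move: (subsetP JsS _ xJ); rewrite !inE.
  by case: eqP => //= _ ->; rewrite andbT; apply: contraNneq zJ => <-.
by rewrite cardsU1 !inE (negPf eS) andbF/=; rewrite (cardsD1 z S) zS in cJ.
Qed.

End Matroids.

(** * Monotone submodular functions *)

Section SetFunctions.
Context {R : realType} {V : finType} (f : {set V} -> R).
Context (f_mono : set_monotone f) (f_submod : set_submodular f).
Implicit Types (X Y : {set V}) (e : V).

Lemma weight_ge0 X e : 0 <= weight f X e.
Proof. by rewrite subr_ge0 f_mono// subsetUr. Qed.

Lemma weight_mem X e : e \in X -> weight f X e = 0.
Proof.
by move=> eX; rewrite /weight /marginal (setUidPr _) ?sub1set// subrr.
Qed.

(** Submodularity speaks only of [e] outside [Y]; inside, the left side vanishes and monotonicity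
    suffices. *)
Lemma weight_le X Y e : X \subset Y -> weight f Y e <= weight f X e.
Proof.
move=> sXY; have [eY|eY] := boolP (e \in Y); last exact: f_submod.
by rewrite weight_mem// weight_ge0.
Qed.

Lemma le_sum_weight T X :
  f (T :|: X) <= f X + \sum_(e in T) weight f X e.
Proof.
have [m] := ubnP #|T|; elim: m T => // m IH T Tm.
have [->|[e eT]] := set_0Vmem T; first by rewrite set0U big_set0 addr0.
rewrite (big_setD1 e)//=.
have := IH (T :\ e); rewrite (cardsD1 e T) eT in Tm; move=> /(_ Tm).
have := weight_le e (subsetUr (T :\ e) X).
rewrite {1}/weight /marginal setUA setD1K//; lra.
Qed.

End SetFunctions.

(** * The counting bound *)

(** Greedy matching: the level at the largest value [v e] supplies a partner [y] with [v e <= w y].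
    Removing both keeps the hypothesis, since levels up to [v e] lose one element on each side and
    higher levels of [T] are empty. *)
Lemma sum_le_of_card_level (R : realType) (V : finType) (T S : {set V})
    (v w : V -> R) : (forall y, y \in S -> 0 <= w y) ->
  (forall t, 0 < t ->
    (#|[set e in T | (t <= v e)%R]| <= #|[set y in S | (t <= w y)%R]|)%N) ->
  \sum_(e in T) v e <= \sum_(y in S) w y.
Proof.
have [m] := ubnP #|T|; elim: m T S => // m IH T S Tm w0 lvl.
have [->|[e0 e0T]] := set_0Vmem T; first by rewrite big_set0 sumr_ge0.
have [e eT emax] : exists2 e, e \in T & forall x, x \in T -> v x <= v e.
  exists [arg max_(x > e0 in T) v x]%O; first by case: arg_maxP.
  by case: arg_maxP.
have [ve|ve] := lerP (v e) 0.
  apply: (@le_trans _ _ 0); last exact: sumr_ge0.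
  by apply: sumr_le0 => x xT; apply: le_trans ve; apply: emax.
have /card_gt0P[y] : (0 < #|[set y in S | (v e <= w y)%R]|)%N.
  by apply: leq_trans (lvl _ ve); apply/card_gt0P; exists e; rewrite inE eT lexx.
rewrite inE => /andP[yS ey].
rewrite (big_setD1 e)//= (big_setD1 y yS)/= lerD//; apply: IH.
- by move: Tm; rewrite (cardsD1 e T) eT.
- by move=> z /setD1P[_ /w0].
move=> t t0; have [te|et] := lerP t (v e); last first.
  rewrite [X in (X <= _)%N](_ : _ = 0%N)//; apply/eqP; rewrite cards_eq0.
  apply/eqP/setP => x; rewrite !inE; apply/negP => /andP[/andP[_ xT]].
  by move/(lt_le_trans et); rewrite ltNge emax.
have := lvl _ t0.
rewrite (cardsD1 e) inE eT te (cardsD1 y [set _ in S | _]) inE yS.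
rewrite (le_trans te ey)/= leq_add2l => le.
have D1E (U : {set V}) (u : V -> R) a : [set x in U :\ a | t <= u x] =
    [set x in U | t <= u x] :\ a.
  by apply/setP => x; rewrite !inE andbA.
by rewrite !D1E.
Qed.

(** * The algorithm *)

Section Invariant.
Context {R : realType} {V : finType} (f : {set V} -> R).
Context (f_mono : set_monotone f) (f_submod : set_submodular f).
Context (f_norm : set_normalized f) (M : matroid V) (n L : nat).
Implicit Types (X T : {set V}) (c : level R V) (e : V) (st : state R V).

(** The factor 2 is that of the swap rule: when [t] is the weight of [e], these are the elements too
    heavy for [e] to replace. *)
Definition heavy c (t : R) : {set V} := [set y in lvS c | t <= 2 * lvW c y].

(** The guard takes care of selected elements, including those swapped out later: they lie in
    [lvS'], so their weight is 0. *)
Definition covered c e : bool :=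
  (0 < weight f (lvS' c) e) ==>
    spanned M (heavy c (weight f (lvS' c) e)) e.

(** [inv_W_le] ranges over all subsets of [lvS c] so that it survives the removal of a swapped
    element. *)
Record solution_inv c : Prop := SolutionInv {
  inv_indep : indep M (lvS c);
  inv_sub : lvS c \subset lvS' c;
  inv_W0 : forall y, y \in lvS c -> 0 <= lvW c y;
  inv_f_le : f (lvS' c) <= 2 * \sum_(y in lvS c) lvW c y;
  inv_W_le : forall T, T \subset lvS c -> \sum_(y in T) lvW c y <= f T }.

Record level_inv X c : Prop := LevelInv {
  inv_sol : solution_inv c;
  inv_SX : lvS c \subset X;
  inv_AX : lvA c \subset X;
  inv_BX : lvB c \subset X;
  inv_AS : [disjoint lvA c & lvS c];
  inv_BS : [disjoint lvB c & lvS c];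
  inv_cov : forall e, e \in X -> e \notin lvA c :|: lvB c -> covered c e }.

Lemma heavy_sub c t : heavy c t \subset lvS c.
Proof. by apply/subsetP => y; rewrite inE => /andP[]. Qed.

Lemma heavy_le c t u : t <= u -> heavy c u \subset heavy c t.
Proof.
by move=> tu; apply/subsetP => y; rewrite !inE => /andP[-> /(le_trans tu)].
Qed.

Lemma approximation c T : solution_inv c -> indep M T ->
  (forall e, e \in T -> covered c e) -> f T <= 4 * f (lvS c).
Proof.
move=> [iS sS W0 fS' fT] iT cov.
apply: (@le_trans _ _ (f (T :|: lvS' c))); first by rewrite f_mono// subsetUl.
apply: (le_trans (le_sum_weight f_mono f_submod _ _)).
suff : \sum_(e in T) weight f (lvS' c) e <= \sum_(y in lvS c) 2 * lvW c y.
  by rewrite -mulr_sumr; have := fT _ (subxx (lvS c)); lra.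
apply: sum_le_of_card_level => [y /W0|t t0]; first by rewrite pmulr_rge0.
(* Both level sets are independent, and each [e] with weight at least [t] is spanned by a heavy set
   contained in [heavy c t]. *)
apply: (@card_le_of_spanned _ M).
- exact: indep_sub (heavy_sub c t) iS.
- by apply: indep_sub iT; apply/subsetP => e; rewrite inE => /andP[].
move=> e; rewrite inE => /andP[eT te].
apply: spanned_sub (heavy_le c te) _.
by move: (cov _ eT); rewrite /covered (lt_le_trans t0 te).
Qed.

(** * Effect of selecting one element *)

Lemma solution_insert c s e : solution_inv c -> e \in addable M c ->
  e \notin lvS c -> solution_inv (select f M c s e).
Proof.
move=> [iS sS W0 fS' fT] eA eS.
have /andP[_ iSe] : (e \in lvA c) && indep M (e |: lvS c) by move: eA; rewrite inE.
have W_e T : e \notin T -> \sum_(y in T) lvW (select f M c s e) y =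
    \sum_(y in T) lvW c y.
  by move=> eT; apply: eq_bigr => y yT /=; case: eqP => // yE; rewrite -yE yT in eT.
have we0 := weight_ge0 f_mono (lvS' c) e.
split; rewrite /= ?eA //.
- by rewrite setUS.
- by move=> y; rewrite !inE; case: eqP => //= _ /W0.
- rewrite (big_setD1 e) ?setU11//= eqxx setU1K// W_e//.
  by move: fS' we0; rewrite /weight /marginal; lra.
move=> T sT; have [eT|eT] := boolP (e \in T); last first.
  rewrite W_e// fT//; apply/subsetP => x xT; move: (subsetP sT _ xT).
  by rewrite !inE; case: eqP => // xE; rewrite -xE xT in eT.
rewrite (big_setD1 e eT)/= eqxx W_e ?setD11//.
have sTS : T :\ e \subset lvS c by rewrite subDset.
(* As [T :\ e] lies in [lvS' c], the weight stored with [e] is at most its marginal gain over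
   [T :\ e]. *)
have := fT _ sTS.
have := weight_le f_mono f_submod e (subset_trans sTS sS).
by rewrite [X in _ <= X]/weight /marginal setD1K//; lra.
Qed.

Lemma solution_swap c s e y : solution_inv c -> e \in lvA c ->
  e \notin addable M c -> e \notin lvS c -> s e = Some y ->
  y \in swap_candidates M (lvS c) e -> 2 * lvW c y < weight f (lvS' c) e ->
  solution_inv (select f M c s e).
Proof.
move=> [iS sS W0 fS' fT] eA eE eS sE; rewrite inE => /andP[yS iSe] lt.
have ye : (y == e) = false by apply: contraNF eS => /eqP <-.
have SE : (e |: lvS c) :\ y = e |: (lvS c :\ y).
  by apply/setP => x; rewrite !inE; case: (x =P e) => [->|//]; rewrite eq_sym ye.
have W_e T : e \notin T -> \sum_(y in T) lvW (select f M c s e) y =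
    \sum_(y in T) lvW c y.
  by move=> eT; apply: eq_bigr => x xT /=; case: eqP => // xE; rewrite -xE xT in eT.
have eSy : e \notin lvS c :\ y by rewrite !inE (negPf eS) andbF.
have we0 := weight_ge0 f_mono (lvS' c) e.
split; rewrite /= ?(negPf eE) ?sE ?SE //.
- by rewrite setUS// (subset_trans (subsetDl _ _)).
- by move=> x; rewrite !inE; case: eqP => //= _ /andP[_ /W0].
- rewrite (big_setD1 e) ?setU11//= eqxx setU1K// W_e//.
  (* Twice the total stored weight rises by 2 v(e) - 2 w(y), which exceeds v(e), the increase of
     f(S'). *)
  move: fS' we0 lt; rewrite (big_setD1 y yS)/= /weight /marginal; lra.
move=> T sT; have sTS : T :\ e \subset lvS c.
  by apply: subset_trans (subsetDl _ [set y]); rewrite subDset.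
have [eT|eT] := boolP (e \in T); last first.
  by rewrite W_e// fT//; rewrite (setDidPl _) // disjoint_sym disjoints1 in sTS.
rewrite (big_setD1 e eT)/= eqxx W_e ?setD11//.
have := fT _ sTS.
have := weight_le f_mono f_submod e (subset_trans sTS sS).
by rewrite [X in _ <= X]/weight /marginal setD1K//; lra.
Qed.

(* Since [y] is the lightest candidate, a heavy set containing [y] contains the
   whole circuit of [e], so exchanging [y] for [e] does not change its span. *)
Lemma heavy_swap c s e y t x : solution_inv c -> 0 < t ->
  e \notin addable M c -> e \in lvA c -> s e = Some y ->
  is_swap M (lvS c) (lvW c) e (Some y) -> 2 * lvW c y < weight f (lvS' c) e ->
  spanned M (heavy c t) x -> spanned M (heavy (select f M c s e) t) x.
Proof.
move=> [iS sS W0 fS' fT] t0 eE eA sE [yC ymin] lt.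
have dS : ~~ indep M (e |: lvS c) by move: eE; rewrite inE eA.
have eS : e \notin lvS c.
  by apply: contra dS => eS; rewrite (setUidPr _)// sub1set.
have /andP[yS iSe] : (y \in lvS c) && indep M (e |: (lvS c :\ y)).
  by move: yC; rewrite inE.
have Wy := W0 _ yS.
have sub z : z != y -> z \in heavy c t -> z \in heavy (select f M c s e) t.
  rewrite !inE /= (negPf eE) sE !inE => -> /andP[zS tz].
  rewrite zS orbT /=; case: eqP => // zE.
  by rewrite zE (negPf eS) in zS.
have [yt|yt] := boolP (y \in heavy c t); last first.
  apply: spanned_sub; apply/subsetP => z zt; apply: sub => //.
  by apply: contraNneq yt => <-.
move=> sp.
have dI : ~~ indep M (e |: heavy c t).
  apply/negP => iI.
  (* Such a candidate outside the heavy set would be lighter than [y]. *)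
  have [z zC zt] := swap_candidate_notin iS (heavy_sub c t) dS iI.
  have := ymin _ zC; move: yt zt zC; rewrite !inE => /andP[_ ty].
  by move=> /negP zt /andP[zS _] yz; apply: zt; rewrite zS /=; lra.
have eI : e \notin heavy c t by rewrite inE (negPf eS).
have iI' : indep M (e |: (heavy c t :\ y)).
  by apply: indep_sub iSe; rewrite setUS// setSD// heavy_sub.
apply: spanned_sub
  (spanned_exchange (indep_sub (heavy_sub c t) iS) yt eI dI iI' sp).
apply/subsetP => z; rewrite in_setU1 in_setD1 => /orP[/eqP ->|/andP[zy]].
  (* The new element is heavy too: t <= 2 w(y) < v(e) < 2 v(e). *)
  rewrite inE /= (negPf eE) sE !inE !eqxx /=; apply/andP; split.
    by rewrite andbT; apply: contraNneq eS => ->.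
  by move: yt; rewrite inE => /andP[_ ty]; lra.
exact: sub.
Qed.

Lemma heavy_insert c s e t x : e \in addable M c -> e \notin lvS c ->
  spanned M (heavy c t) x -> spanned M (heavy (select f M c s e) t) x.
Proof.
move=> eE eS; apply: spanned_sub; apply/subsetP => z.
rewrite !inE /= eE !inE => /andP[zS tz]; rewrite zS orbT /=.
by case: eqP => // zE; rewrite zE (negPf eS) in zS.
Qed.

(** If the heavy set did not span [e], some swap candidate would lie outside it; the lightest
    candidate would then be light enough for [e] to pass the swap test. *)
Lemma covered_rejected c s e : solution_inv c -> e \in lvA c ->
  is_swap M (lvS c) (lvW c) e (s e) ->
  e \notin addable M c :|: swappable f M c s -> covered c e.
Proof.
move=> [iS _ _ _ _] eA sw; rewrite inE negb_or => /andP[eE eF].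
have dS : ~~ indep M (e |: lvS c) by move: eE; rewrite inE eA.
apply/implyP => t0; apply/orP; right; apply/negP => iI.
have [z zC zt] := swap_candidate_notin iS (heavy_sub c _) dS iI.
move: eF sw; rewrite inE inE eE eA /=.
case: (s e) => [y|_] /= => [/negP yt [yC ymin]|C0]; last first.
  by rewrite C0 inE in zC.
apply: yt; have := ymin _ zC; move: zt zC; rewrite !inE => zt /andP[zS _].
by move: zt; rewrite zS /= -ltNge; lra.
Qed.

(** * The invariant during the construction of levels *)

Lemma iteration_inv X t c c' : iteration f M t c c' -> lvB c = set0 ->
  level_inv X c -> level_inv X c' /\ lvB c' = set0.
Proof.
move=> [s sw it] B0 [sol SX AX BX AS BS cov].
set A := addable M c :|: swappable f M c s in it.
have sA : A \subset lvA c.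
  by apply/subsetP => e; rewrite !inE => /orP[/andP[]//|/andP[/andP[]]].
have covA e : e \in X -> e \notin A -> covered c e.
  move=> eX eA; have [eAc|eAc] := boolP (e \in lvA c).
    exact: covered_rejected (sw _ eAc) eA.
  by apply: cov; rewrite // B0 setU0.
have ASd : [disjoint A & lvS c] by apply: disjointWl sA AS.
move: it => /=; case: ifP => _ => [[e eA ->]|->]; last first.
  split=> //; split=> //=; first by case: sol.
    exact: subset_trans AX.
  by rewrite B0 setU0.
have eAc := subsetP sA _ eA; have eX := subsetP AX _ eAc.
have eS : e \notin lvS c by rewrite (disjointFr AS).
(* Weights only drop as [lvS'] grows, so coverage later asks for the span of a larger heavy set. *)
have wle x : weight f (e |: lvS' c) x <= weight f (lvS' c) x.
  by apply: weight_le => //; apply: subsetUr.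
have step : solution_inv (select f M c s e) /\
    forall x u, 0 < u -> spanned M (heavy c u) x ->
      spanned M (heavy (select f M c s e) u) x.
  have [eE|eE] := boolP (e \in addable M c).
    by split=> [|x u _]; [exact: solution_insert|exact: heavy_insert].
  have := sw _ eAc; move: (eA); rewrite inE (negPf eE) /= inE => /andP[_].
  case sE : (s e) => [y|//] lt swy.
  split=> [|x u u0]; first by apply: solution_swap sE _ lt => //; case: swy.
  exact: heavy_swap sE swy lt.
have [sol' sp'] := step.
have S'e : lvS (select f M c s e) \subset e |: lvS c.
  by rewrite /=; case: ifP => // _; case: (s e) => // y; apply: subsetDl.
split=> //; split=> //.
- by apply: (subset_trans S'e); rewrite subUset sub1set eX.
- exact: subset_trans (subset_trans (subsetDl _ _) sA) AX.
- apply: disjointWr S'e _; rewrite disjoint_sym disjoint_setU disjoints1 setD11 /=.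
  by rewrite disjoint_sym; apply: disjointWl ASd; apply: subsetDl.
- by rewrite /= B0 disjoints_subset sub0set.
move=> x xX; rewrite /= B0 setU0 in_setD1 negb_and negbK => xA.
apply/implyP => /= wx.
have [xE|xe] := eqVneq x e; first by rewrite weight_mem ?xE ?setU11 ?ltxx in wx.
rewrite (negPf xe) /= in xA.
apply: sp' => //; apply: spanned_sub (heavy_le c (wle x)) _.
by move: (covA _ xX xA); rewrite /covered (lt_le_trans wx (wle x)).
Qed.

Lemma repeat_until_inv X t c c' : repeat_until f M t c c' -> lvB c = set0 ->
  level_inv X c -> [/\ level_inv X c', lvB c' = set0 & (#|lvA c'| < t)%N].
Proof.
elim=> {c c'} [c c' it lt|c c' c'' it _ _ IH] B0 inv.
  by have [? ?] := iteration_inv it B0 inv.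
have [inv' B0'] := iteration_inv it B0 inv.
exact: IH.
Qed.

Definition settled c : Prop := lvA c = set0 /\ lvB c = set0.

Lemma solution_empty : solution_inv (Level set0 set0 set0 set0 (fun=> 0)).
Proof.
split=> /= [|//|y|/=|T]; rewrite ?indep0 ?inE //.
  by rewrite f_norm big_set0 mulr0.
by rewrite subset0 => /eqP ->; rewrite big_set0 f_norm.
Qed.

(** Level 0 starts with all of [X] in [lvA]. A later level inherits the solution of its predecessor
    and the union of [lvA] and [lvB], hence also its coverage. *)
Lemma start_level_inv X st l : (forall j, (j < l)%N -> level_inv X (st j)) ->
  level_inv X (start_level X st l).
Proof.
case: l => [_|l /(_ l (ltnSn l)) [[iS sS W0 fS fT] SX AX BX AS BS cov]] /=.
  have [iS sS W0 fS fT] := solution_empty.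
  split=> //=; rewrite ?sub0set ?disjoints_subset ?sub0set //.
    by apply/subsetP => x _; rewrite inE inE.
  by move=> e eX; rewrite setU0 eX.
split=> //=; rewrite ?sub0set ?subUset ?AX ?BX ?disjoint_setU ?AS //.
  by rewrite disjoints_subset sub0set.
by move=> e eX; rewrite setU0; apply: cov.
Qed.

(** Only the levels below [l] need be intact beforehand, since all others are rebuilt from them. *)
Lemma level_construct_inv X l st st' : n = (2 ^ L)%N ->
  level_construct f M n L X l st st' -> (l <= L)%N ->
  (forall j, (j < l)%N -> level_inv X (st j)) ->
  (forall j, (j <= L)%N -> level_inv X (st' j)) /\ settled (st' L).
Proof.
move=> nE; elim=> {l st st'} [st c rep|l st c st' lL rep _ IH] lL' inv.
  have B0 : lvB (start_level X st L) = set0 by case: {+}L.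
  have [invc B0c] := repeat_until_inv rep B0 (start_level_inv inv).
  (* The threshold of level [L] is 1, so its loop stops only once [lvA] is empty. *)
  rewrite /threshold nE divnn expn_gt0 /= ltnS leqn0 cards_eq0 => /eqP A0c.
  split; last by rewrite /set_level eqxx.
  move=> j jL; rewrite /set_level; case: eqP => [//|/eqP jL'].
  by apply: inv; rewrite ltn_neqAle jL'.
have B0 : lvB (start_level X st l) = set0 by case: {+}l.
have [invc _ _] := repeat_until_inv rep B0 (start_level_inv inv).
apply: IH => // j jl; rewrite /set_level; case: eqP => [//|/eqP jl'].
by apply: inv; rewrite ltn_neqAle jl' -ltnS.
Qed.

Lemma least_levelP P : match least_level L P with
  | Some l => [/\ (l <= L)%N, P l & forall j, (j < l)%N -> ~~ P j]
  | None => forall j, (j <= L)%N -> ~~ P j end.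
Proof.
rewrite /least_level.
have mem j : j \in [seq l <- iota 0 L.+1 | P l] = P j && (j <= L)%N.
  by rewrite mem_filter mem_iota.
have : sorted ltn [seq l <- iota 0 L.+1 | P l].
  by apply: sorted_filter; [exact: ltn_trans|exact: iota_ltn_sorted].
case: filter mem => [mem _ j jL|l r mem /= pth].
  by have := mem j; rewrite in_nil jL andbT => <-.
have /andP[Pl lL] : P l && (l <= L)%N by rewrite -mem mem_head.
split=> // j jl; apply/negP => Pj.
have : j \in l :: r by rewrite mem Pj (leq_trans (ltnW jl)).
rewrite in_cons => /orP[/eqP jE|jr]; first by rewrite jE ltnn in jl.
move: pth; rewrite (path_sortedE ltn_trans) => /andP[/allP/(_ _ jr) /= lj _].
by have := ltn_trans jl lj; rewrite ltnn.
Qed.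

(** * The invariant along the stream *)

Definition state_inv X st : Prop :=
  (forall j, (j <= L)%N -> level_inv X (st j)) /\ settled (st L).

Lemma insertion_inv X e st st' : n = (2 ^ L)%N -> e \notin X ->
  state_inv X st -> insertion f M n L (e |: X) e st st' ->
  state_inv (e |: X) st'.
Proof.
move=> nE eX [inv _]; rewrite /insertion /construct_from.
set P := fun l => _; have := least_levelP P.
case: least_level => [l [lL _ _]|]; last first.
  (* An insertion always triggers a reconstruction: [lvB] at level [L] contains [e] and the
     threshold there is 1. *)
  move=> /(_ L (leqnn L)); rewrite /P /= /threshold nE divnn expn_gt0 /=.
  by rewrite card_gt0 => /negP[]; apply/set0Pn; exists e; rewrite setU11.
move=> con; apply: (level_construct_inv nE con lL) => j jl.
have [[iS sS W0 fS fT] SX AX BX AS BS cov] := inv j (ltnW (leq_trans jl lL)).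
have sX : X \subset e |: X by apply: subsetUr.
split=> //=; rewrite ?setUS ?(subset_trans _ sX) //.
  rewrite disjoint_setU disjoints1 BS andbT.
  by apply: contra eX; apply: (subsetP SX).
move=> x xX; rewrite setUCA in_setU1 negb_or => /andP[xe xAB].
by apply: cov => //; move: xX; rewrite in_setU1 (negPf xe).
Qed.

(** Coverage depends only on [lvS], [lvS'] and [lvW], which stay as they are; [e] may remain in
    [lvS']. *)
Lemma deletion_level_inv X e c : level_inv X c -> e \notin lvS c ->
  level_inv (X :\ e)
    (Level (lvA c :\ e) (lvB c :\ e) (lvS c) (lvS' c) (lvW c)).
Proof.
move=> [[iS sS W0 fS fT] SX AX BX AS BS cov] eS.
split=> //=; rewrite ?setSD ?subsetD1 ?SX ?(disjointWl (subsetDl _ _)) //.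
move=> x /setD1P[xe xX]; rewrite -setDUl in_setD1 xe => /= xAB.
exact: cov.
Qed.

Lemma deletion_inv X e st st' : n = (2 ^ L)%N ->
  state_inv X st -> deletion f M n L (X :\ e) e st st' ->
  state_inv (X :\ e) st'.
Proof.
move=> nE [inv [A0 B0]]; rewrite /deletion /construct_from.
set P := fun l => _; have := least_levelP P.
case: least_level => [l [lL _ min] con|none ->].
  apply: (level_construct_inv nE con lL) => j jl.
  exact: deletion_level_inv (inv j (ltnW (leq_trans jl lL))) (min j jl).
split=> [j jL|]; first exact: deletion_level_inv (inv j jL) (none j jL).
by split=> /=; rewrite ?A0 ?B0 set0D.
Qed.

Lemma present_rcons (ops : seq (op V)) o :
  present (rcons ops o) = apply_op (present ops) o.
Proof. by rewrite /present foldl_rcons. Qed.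

Lemma legal_prefix (ops1 ops2 : seq (op V)) :
  legal_stream (ops1 ++ ops2) -> legal_stream ops1.
Proof.
by move=> leg o1 o o2 E; apply: (leg o1 o (o2 ++ ops2)); rewrite E -catA.
Qed.

Lemma outcome_inv ops st : n = (2 ^ L)%N -> legal_stream ops ->
  outcome f M n L ops st -> state_inv (present ops) st.
Proof.
move=> nE + out; elim: out => {ops st} [_|ops o st st' _ IH pr leg].
  split=> // j _; have [iS sS W0 fS fT] := solution_empty.
  split=> //=; rewrite ?sub0set // ?disjoints_subset ?sub0set //.
  by move=> e; rewrite inE.
have inv : state_inv (present ops) st.
  by apply: IH; apply: (@legal_prefix _ [:: o]); rewrite cats1.
have lo : legal_op (present ops) o.
  by apply: (leg ops o [::]); rewrite cats1.
move: pr lo; rewrite present_rcons; case: o {leg} => e /= pr lo.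
  exact: insertion_inv pr.
exact: deletion_inv pr.
Qed.

End Invariant.

Theorem theorem4 (R : realType) (V : finType) (f : {set V} -> R)
    (f_nonneg : set_nonneg f) (f_mono : set_monotone f)
    (f_submod : set_submodular f) (f_norm : set_normalized f)
    (M : matroid V) (n L : nat) (nE : n = (2 ^ L)%N)
    (ops : seq (op V)) (ops_legal : legal_stream ops)
    (ops_ins : count is_ins ops = n) (ops_del : count is_del ops = n)
    (i : nat) (i_range : (1 <= i <= 2 * n)%N)
    (st : state R V) (run : outcome f M n L (take i ops) st) :
  let Vi := present (take i ops) in
  let Si := lvS (st L) in
  [/\ indep M Si, Si \subset Vi & opt f M Vi <= 4 * f Si].
Proof.
move=> Vi Si.
have leg : legal_stream (take i ops).
  by apply: (@legal_prefix _ _ (drop i ops)); rewrite cat_take_drop.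
have [inv [A0 B0]] := outcome_inv f_mono f_submod f_norm nE leg run.
have [sol SX _ _ _ _ cov] := inv L (leqnn L).
have [iS _ _ _ _] := sol.
have approx (T : {set V}) : T \subset Vi -> indep M T -> f T <= 4 * f Si.
  move=> sT iT; apply: approximation sol iT _ => // e eT.
  by apply: cov; rewrite ?(subsetP sT)// A0 B0 setU0 inE.
(* The default value [f set0] of the maximum is bounded by applying [approx] to the empty set. *)
split=> //; apply: bigmax_le; first by apply: approx; rewrite ?sub0set ?indep0.
by move=> T /andP[]; apply: approx.
Qed.
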